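(* In the spectrum pooling game $\mathcal G$, the Jacobi-play (JP) dynamic converges to the unique Nash equilibrium if, for all $t\ge0$ and all $i,j$ with $j\neq i$, $$-1<J_{ij}^{BR}<0\qquad\text{and}\qquad 0<\kappa_i^{(t)}<\kappa_{i,max}^{(t)},\quad\text{where }\ \kappa_{i,max}^{(t)}=\frac{2}{1+(N-1)|J_{ij}^{BR}|}.$$
   Context: $\mathcal G$ is an $N$-player ($N\ge2$) non-cooperative game: player (operator) $i$ chooses $\beta_i\in S_i=[\beta_i^{min},\beta_i^{max}]$ and has a twice continuously differentiable utility $U_i(\beta_i,\boldsymbol\beta_{-i})$ that is concave in $\beta_i$ (understood as $\partial^2U_i/\partial\beta_i^2<0$) and depends on the opponents' strategies only through their sum $\sum_{j\ne i}\beta_j$. $BR_i(\boldsymbol\beta_{-i})=\arg\max_{\beta_i\in S_i}U_i(\beta_i,\boldsymbol\beta_{-i})$ is the best response. The JP dynamic is the parallel update $$\beta_i^{(t)}=(1-\kappa_i^{(t)})\beta_i^{(t-1)}+\kappa_i^{(t)}BR_i(\boldsymbol\beta_{-i}^{(t-1)}),\quad\forall i,$$ with smoothing parameters $\kappa_i^{(t)}>0$. $J_{ij}^{BR}=J_{ij}^{BR(t)}=\frac{\partial BR_i(\boldsymbol\beta_{-i}^{(t-1)})}{\partial\beta_j}$ ($j\neq i$) is the slope of the best response at the current iterate; for fixed $i$ it is the same for all $j\ne i$, so $\kappa_{i,max}^{(t)}$ does not depend on $j$. In the paper, convergence of an iterative update $\boldsymbol\beta^{(t)}=M(\boldsymbol\beta^{(t-1)})$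 is understood by the criterion that the Jacobian $[\partial M_i/\partial\beta_j]$ has all eigenvalues of absolute value less than one. *)

(* Defs.v *)
From HB Require Import structures.
From mathcomp Require Import all_boot all_order all_algebra.
From mathcomp Require Import complex.
From mathcomp Require Import all_classical all_reals all_analysis.
Set Implicit Arguments.
Unset Strict Implicit.
Unset Printing Implicit Defensive.
Import Order.TTheory GRing.Theory Num.Theory numFieldNormedType.Exports.
Local Open Scope classical_set_scope.
Local Open Scope ring_scope.

Section Box.
Variables (R : realType) (N : nat) (lo hi : 'I_N -> R).
Implicit Types (f : 'rV[R]_N -> R) (b : 'rV[R]_N) (i j k : 'I_N) (x : R).

Definition box : set 'rV[R]_N := [set b | forall i, b 0 i \in `[lo i, hi i]].

(* The profile (x, b_{-i}). *)
Definition replace b i x : 'rV[R]_N := \row_j (if j == i then x else b 0 j).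

(* Partial derivatives relative to the box: two-sided at points with b_j inside
   ]lo j, hi j[, one-sided when b_j is an endpoint. The filter is proper as
   soon as lo j < hi j and b is in the box, so the limit is then unique. *)
Definition pquotient f j b x : R := (f (replace b j x) - f b) / (x - b 0 j).

Definition pderivable f j b : Prop :=
  cvg (pquotient f j b x @[x --> within `[lo j, hi j] (b 0 j)^']).

Definition pderive f j b : R :=
  lim (pquotient f j b x @[x --> within `[lo j, hi j] (b 0 j)^']).

Definition C2_on_box f : Prop :=
  [/\ {within box, continuous f},
      (forall j, (forall b, box b -> pderivable f j b) /\
                 {within box, continuous (pderive f j)})
    & (forall j k, (forall b, box b -> pderivable (pderive f j) k b) /\
                   {within box, continuous (pderive (pderive f j) k)})].

End Box.

(* Utilities are only constrained on the strategy space; a utility is a function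
   of the whole profile, its i-th coordinate being the own strategy. *)
Record pooling_game (R : realType) (N : nat) := PoolingGame {
  bmin : 'I_N -> R;
  bmax : 'I_N -> R;
  utility : 'I_N -> 'rV[R]_N -> R;
  bmin_lt_bmax : forall i, bmin i < bmax i;
  utility_C2 : forall i, C2_on_box bmin bmax (utility i);
  utility_concave : forall i b, box bmin bmax b ->
    pderive bmin bmax (pderive bmin bmax (utility i) i) i b < 0;
  utility_aggregative : forall i b c, box bmin bmax b -> box bmin bmax c ->
    b 0 i = c 0 i -> \sum_(j < N | j != i) b 0 j = \sum_(j < N | j != i) c 0 j ->
    utility i b = utility i c }.

Section Game.
Variables (R : realType) (N : nat) (G : pooling_game R N).
Implicit Types (b : 'rV[R]_N) (i j : 'I_N) (kappa : 'I_N -> R).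

Definition profiles : set 'rV[R]_N := box (bmin G) (bmax G).

Definition best_responses i b : set R :=
  [set x | x \in `[bmin G i, bmax G i] /\
     forall y, y \in `[bmin G i, bmax G i] ->
       utility G i (replace b i y) <= utility G i (replace b i x)].

(* On the strategy space [best_responses i b] is a singleton, by compactness and
   strict concavity; [BR i b] is its element. It does not depend on b 0 i. *)
Definition BR i b : R := get (best_responses i b).

Definition nash b : Prop :=
  profiles b /\
  forall i y, y \in `[bmin G i, bmax G i] ->
    utility G i (replace b i y) <= utility G i b.

Definition BR_derivable i j b : Prop := pderivable (bmin G) (bmax G) (BR i) j b.

Definition BR_slope i j b : R := pderive (bmin G) (bmax G) (BR i) j b.

Definition kappa_max i j b : R := 2 / (1 + (N%:R - 1) * `|BR_slope i j b|).

Definition JP_map kappa b : 'rV[R]_N :=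
  \row_i ((1 - kappa i) * b 0 i + kappa i * BR i b).

(* Smoothing parameters above 1 may overshoot the best response; a run is
   required to consist of admissible strategy profiles. *)
Definition JP_run (kappa : nat -> 'I_N -> R) (beta : nat -> 'rV[R]_N) : Prop :=
  (forall t, profiles (beta t)) /\
  (forall t, beta t.+1 = JP_map (kappa t.+1) (beta t)).

Definition map_derivable (M : 'rV[R]_N -> 'rV[R]_N) b : Prop :=
  forall i j, pderivable (bmin G) (bmax G) (fun c => M c 0 i) j b.

Definition jacobian (M : 'rV[R]_N -> 'rV[R]_N) b : 'M[R]_N :=
  \matrix_(i, j) pderive (bmin G) (bmax G) (fun c => M c 0 i) j b.

Definition spectrum_lt1 (A : 'M[R]_N) : Prop :=
  forall a : R[i]%C, eigenvalue (map_mx (real_complex R) A) a -> `|a| < 1.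

(* Convergence of the iteration to bstar in the sense of the Jacobian
   (eigenvalue) criterion: bstar is the only rest point of every update, and the
   Jacobian of the update, taken at the current iterate, has all its complex
   eigenvalues in the open unit disc. It is not convergence of the sequence
   beta itself, which fails for instance when the kappa t are summable. *)
Definition JP_converges (kappa : nat -> 'I_N -> R) (beta : nat -> 'rV[R]_N)
    (bstar : 'rV[R]_N) : Prop :=
  forall t,
    [/\ (forall b, profiles b -> JP_map (kappa t.+1) b = b <-> b = bstar),
        map_derivable (JP_map (kappa t.+1)) (beta t)
      & spectrum_lt1 (jacobian (JP_map (kappa t.+1)) (beta t))].

End Game.

(* Main.v *)
Require Import Defs.
From HB Require Import structures.
From mathcomp Require Import all_boot all_order all_algebra.
From mathcomp Require Import complex.
From mathcomp Require Import ring lra.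
From mathcomp Require Import all_classical all_reals all_analysis.
Set Implicit Arguments.
Unset Strict Implicit.
Unset Printing Implicit Defensive.
Import Order.TTheory GRing.Theory Num.Theory numFieldNormedType.Exports.
Local Open Scope classical_set_scope.
Local Open Scope ring_scope.

(* The best response of player i is a function [reply i] of the opponents' sum, so
   its partial slopes at a profile agree, to s_i in ]-1, 0[. The Jacobian of the JP
   update is therefore diagonal plus rank one, with rows
   (1 - kappa_i) e_i + kappa_i s_i (1 - e_i); it is similar to D - w w^T, which makes
   its eigenvalues real. They are < 1 because the diagonal of D is, and > -1 by
   Cauchy-Schwarz together with kappa_i (1 + (N - 1) |s_i|) < 2.

   For existence and uniqueness of the equilibrium, s_i in ]-1, 0[ makes
   x = reply i (S - x) uniquely solvable for every total S, with a solution r_i S that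
   is continuous and nonincreasing in S; an equilibrium is a solution of
   \sum_i r_i S = S. *)

(** * Spectrum of a diagonal plus rank-one matrix *)

(** Cauchy-Schwarz against the constant vector: the nonnegative double sum of [(|x i| - |x j|)^2]
    equals [2 (n Q - S^2)], and [S] bounds the norm of the sum. *)
Lemma sqr_norm_sum_le (C : numClosedFieldType) (n : nat) (x : 'I_n -> C) :
  `|\sum_i x i| ^+ 2 <= n%:R * \sum_i `|x i| ^+ 2.
Proof.
rewrite (le_trans (_ : _ <= (\sum_i `|x i|) ^+ 2))//.
  by rewrite lerXn2r ?nnegrE// ?sumr_ge0// ler_norm_sum.
have: 0 <= \sum_i \sum_j (`|x i| - `|x j|) ^+ 2.
  by apply: sumr_ge0 => i _; apply: sumr_ge0 => j _; rewrite real_exprn_even_ge0// rpredB.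
pose S := \sum_i `|x i|; pose Q := \sum_i `|x i| ^+ 2.
have E i : \sum_j (`|x i| - `|x j|) ^+ 2 =
    n%:R * `|x i| ^+ 2 + (- S *+ 2) * `|x i| + Q.
  transitivity (\sum_j (`|x i| ^+ 2 + (- `|x i| *+ 2) * `|x j| + `|x j| ^+ 2)).
    by apply: eq_bigr => j _; ring.
  by rewrite !big_split/= sumr_const card_ord -mulr_sumr -/S -/Q; ring.
under eq_bigr => i _ do rewrite E.
rewrite !big_split/= sumr_const card_ord -!mulr_sumr -/S -/Q -[Q *+ n]mulr_natl.
have -> : n%:R * Q + - S *+ 2 * S + n%:R * Q = (n%:R * Q - S ^+ 2) *+ 2 by ring.
by rewrite pmulrn_lge0// subr_ge0.
Qed.

(* Weighting the j-th eigenvector equation by [w j * v_j^*] gives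
   [a * W = \sum_j w j * d j * |v_j|^2 - |\sum_j w j * v_j|^2] with [W > 0],
   which shows that [a] is real and brackets it. *)
Lemma diag_rank1_eigenvalue_lt1 (C : numClosedFieldType) (n : nat)
    (d w : 'I_n -> C) (a : C) :
  (forall i, 0 < w i) -> (forall i, d i < 1) ->
  (forall i, n%:R * w i < 1 + d i) ->
  eigenvalue (\matrix_(i, j) ((i == j)%:R * d i - w i)) a -> `|a| < 1.
Proof.
move=> w0 d1 nwd /eigenvalueP[v vA v0].
have dR i : d i \is Num.real.
  by rewrite -(subKr 1 (d i)) realB ?real1// gtr0_real// subr_gt0.
pose T := \sum_i w i * v 0 i.
have vE j : a * v 0 j = d j * v 0 j - T.
  move/rowP: vA => /(_ j); rewrite !mxE => <-.
  under eq_bigr => i _ do rewrite mxE mulrBr.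
  rewrite sumrB (bigD1 j)//= eqxx mul1r big1 ?addr0; last first.
    by move=> i /negbTE ->; rewrite mul0r mulr0.
  by congr (_ - _); [rewrite mulrC | apply: eq_bigr => i _; rewrite mulrC].
pose W := \sum_i w i * `|v 0 i| ^+ 2.
(* The index [k] makes [W] positive and both bounds on [a] strict. *)
have [k vk0] : exists k, v 0 k != 0.
  by apply/existsP; apply: contra_neqT v0 => /existsPn v0; apply/rowP => i;
     rewrite mxE; apply/eqP; rewrite -[_ == _]negbK v0.
have W0 : 0 < W.
  rewrite /W (bigD1 k)//= ltr_pwDl ?mulr_gt0 ?exprn_gt0 ?normr_gt0//.
  by apply: sumr_ge0 => i _; rewrite mulr_ge0 ?exprn_ge0// ltW.
have aW : a * W = \sum_i w i * d i * `|v 0 i| ^+ 2 - `|T| ^+ 2.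
  have -> : `|T| ^+ 2 = \sum_i w i * (T * (v 0 i)^*).
    rewrite normCK {2}/T rmorph_sum mulr_sumr; apply: eq_bigr => i _.
    by rewrite rmorphM/= (CrealP (gtr0_real (w0 i))) mulrCA.
  rewrite -sumrB mulr_sumr; apply: eq_bigr => i _.
  by rewrite normCK mulrCA !mulrA -(mulrA (w i) a) vE; ring.
have aE : a = (\sum_i w i * d i * `|v 0 i| ^+ 2 - `|T| ^+ 2) / W.
  by rewrite -aW mulfK// gt_eqF.
have aR : a \is Num.real.
  rewrite aE realM ?realV ?(gtr0_real W0)//; apply: realB; last by rewrite realX ?normr_real.
  by apply: sum_real => i _; rewrite !realM ?realX ?normr_real ?dR// gtr0_real.
(* Upper bound: discard [|T|^2], then use [d i < 1] term by term. *)
rewrite real_ltr_norml//; apply/andP; split; last first.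
  rewrite -(ltr_pM2r W0) mul1r aW (le_lt_trans (_ : _ <= \sum_i w i * d i * `|v 0 i| ^+ 2))//.
    by rewrite gerBl exprn_ge0.
  rewrite /W (bigD1 k)//= [ltRHS](bigD1 k)//= ltr_leD//.
    by rewrite ltr_pM2r ?exprn_gt0 ?normr_gt0// gtr_pMr.
  by apply: ler_sum => i _; rewrite ler_wpM2r ?exprn_ge0// ger_pMr// ltW.
(* Lower bound: Cauchy-Schwarz on the terms [w i * v 0 i] of [T] leaves the termwise inequality
   [n * w i < 1 + d i]. *)
rewrite -(ltr_pM2r W0) aW mulN1r -subr_gt0 opprK addrAC subr_gt0.
rewrite (le_lt_trans (sqr_norm_sum_le _))//.
rewrite /W -big_split/= mulr_sumr (bigD1 k)//= [ltRHS](bigD1 k)//=.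
have E i : n%:R * `|w i * v 0 i| ^+ 2 = w i * `|v 0 i| ^+ 2 * (n%:R * w i).
  by rewrite normrM (gtr0_norm (w0 i)); ring.
have F i : w i * d i * `|v 0 i| ^+ 2 + w i * `|v 0 i| ^+ 2 = w i * `|v 0 i| ^+ 2 * (1 + d i).
  by ring.
rewrite ltr_leD//.
  by rewrite E F ltr_pM2l// mulr_gt0 ?exprn_gt0 ?normr_gt0.
by apply: ler_sum => i _; rewrite E F ler_wpM2l ?mulr_ge0 ?exprn_ge0// ltW.
Qed.

(** * Difference quotients and partial derivatives on a box *)

Definition quotient (R : realType) (f : R -> R) (y x : R) : R :=
  (f x - f y) / (x - y).

(** Used to turn a limit in one opponent's strategy into a limit in the opponents' sum, the two
    variables differing by a translation. *)
Lemma cvg_within_shift (R : realType) (T : topologicalType) (A B : set R)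
    (F : R -> T) (y z : R) (l : T) :
  (\forall x \near y, A x -> B (x - y + z)) ->
  F x @[x --> within B z^'] --> l -> F (x - y + z) @[x --> within A y^'] --> l.
Proof.
move=> AB Fl U /Fl; rewrite /= !nbhs_simpl/=.
rewrite -[X in X -> _]/(nbhs z (fun x => x != z -> B x -> U (F x))).
rewrite -[X in _ -> X]/(nbhs y (fun x => x != y -> A x -> U (F (x - y + z)))).
move=> H; have {}H : \forall x \near z, x != z -> B x -> U (F x) by exact: H.
rewrite (near_shift y) in H.
apply: filterS2 AB H => x AB /= H xy /AB Bx.
have e : x + (z - y) = x - y + z by ring.
by rewrite -e; apply: H; rewrite e// -subr_eq0 addrK subr_eq0.
Qed.

Lemma quotient_is_derive (R : realType) (f : R -> R) (y l : R) :
  quotient f y x @[x --> y^'] --> l -> is_derive y 1 f l.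
Proof.
move=> fl.
have H : (fun h => h^-1 *: (f (h *: (1:R) + y) - f y)) @ 0^' --> l.
  have : quotient f y (x - 0 + y) @[x --> within setT (0:R)^'] --> l.
    apply: (@cvg_within_shift _ _ setT setT).
      exact: (@filterE _ (nbhs (0:R)) _ _ (fun _ _ => I)).
    move=> U /fl fU.
    have {}fU : nbhs y (fun x => x != y -> U (quotient f y x)) := fU.
    change (nbhs y (fun x => x != y -> setT x -> U (quotient f y x))).
    by apply: filterS fU => x fU xy _; exact: fU.
  move=> H U /H {}H.
  have {}H : nbhs (0:R) (fun x => x != 0 -> setT x -> U (quotient f y (x - 0 + y))) := H.
  change (nbhs (0:R) (fun h => h != 0 -> U (h^-1 *: (f (h *: 1 + y) - f y)))).
  apply: filterS H => h H h0; move: (H h0 I).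
  by rewrite /quotient subr0 addrK -[h *: 1]/(h * 1) mulr1 mulrC.
by split; [apply/cvg_ex; exists l | apply: cvg_lim].
Qed.

(** Off [y], [f x = f y + quotient f y x * (x - y)], and the second term tends to 0. The conclusion
    is over the unpunctured filter, so [x = y] is treated apart. *)
Lemma quotient_cvg_continuous (R : realType) (f : R -> R) (A : set R) (y l : R) :
  quotient f y x @[x --> within A y^'] --> l -> f x @[x --> within A (nbhs y)] --> f y.
Proof.
move=> fl.
have H : f x @[x --> within A y^'] --> f y.
  have -> : f y = f y + l * (y - y) by rewrite subrr mulr0 addr0.
  have : f y + quotient f y x * (x - y) @[x --> within A y^'] --> f y + l * (y - y).
    apply: cvgD; first exact: cvg_cst.
    apply: cvgM => //; apply: cvgB; last exact: cvg_cst.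
    by apply: cvg_within_filter; apply: cvg_within_filter; exact: cvg_id.
  apply: cvg_trans; apply: near_eq_cvg.
  apply: (@filterE _ (nbhs y)) => x xy _.
  by rewrite /quotient divfK ?subr_eq0//; ring.
move=> U Uy; have := H U Uy; rewrite /= !nbhs_simpl/=.
rewrite -[X in X -> _]/(nbhs y (fun x => x != y -> A x -> U (f x))).
rewrite -[X in _ -> X]/(nbhs y (fun x => A x -> U (f x))).
apply: filterS => x Hx Ax; have [->|xy] := eqVneq x y; last exact: Hx.
exact: nbhs_singleton.
Qed.

Lemma within_dnbhs_proper (R : realType) (A : set R) (y e : R) :
  0 < e -> `]y, y + e[%classic `<=` A \/ `]y - e, y[%classic `<=` A ->
  ProperFilter (within A y^').
Proof.
move=> e0 He; apply: Build_ProperFilter_ex => P.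
rewrite -[X in X -> _]/(nbhs y (fun x => x != y -> A x -> P x)).
move=> /nbhs_ballP[d /= d0 H].
(* Halving the minimum puts [y + m] or [y - m] strictly inside both the ball of radius [d] and the
   interval of length [e]. *)
pose m := Num.min d e / 2.
have m0 : 0 < m by rewrite divr_gt0// lt_min d0 e0.
have md : m < d.
  by rewrite /m; case: (leP d e) => de; lra.
have me : m < e by rewrite /m; case: (leP d e) => de; lra.
case: He => He.
  exists (y + m); apply: H => /=.
  - by rewrite /ball/= opprD addNKr normrN gtr0_norm.
  - by lra.
  - by apply: He => /=; rewrite in_itv/=; lra.
exists (y - m); apply: H => /=.
- by rewrite /ball/= opprD opprK addNKr gtr0_norm.
- by lra.
- by apply: He => /=; rewrite in_itv/=; lra.
Qed.

Lemma itv_ooW (R : realType) (a b x : R) : x \in `]a, b[ -> x \in `[a, b].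
Proof. by rewrite !in_itv/= => /andP[? ?]; rewrite !ltW. Qed.

Lemma sub_itv (R : realType) (a b x y : R) : x \in `[a, b] -> y \in `[a, b] ->
  `[x, y]%classic `<=` `[a, b]%classic.
Proof. by rewrite !in_itv/= => ? ? z /=; rewrite !in_itv/=; lra. Qed.

Lemma sub_itv_oo (R : realType) (a b x y z : R) : x \in `[a, b] -> y \in `[a, b] ->
  z \in `]x, y[ -> z \in `]a, b[.
Proof. by rewrite !in_itv/=; lra. Qed.

Lemma quotient_itv_is_derive (R : realType) (f : R -> R) (a b y l : R) :
  y \in `]a, b[ -> quotient f y x @[x --> within `[a, b] y^'] --> l -> is_derive y 1 f l.
Proof.
move=> yab fl; apply: quotient_is_derive => U /fl fU.
have {}fU : nbhs y (fun x => x != y -> x \in `[a, b] -> U (quotient f y x)) := fU.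
change (nbhs y (fun x => x != y -> U (quotient f y x))).
have yn : \forall x \near y, x \in `]a, b[ by exact: near_in_itvoo.
by apply: filterS2 yn fU => x xj fU xy; apply: fU => //; exact: itv_ooW.
Qed.

Section Profiles.
Variables (R : realType) (N : nat) (lo hi : 'I_N -> R).
Implicit Types (f : 'rV[R]_N -> R) (b c : 'rV[R]_N) (i j : 'I_N) (x y : R).

Lemma replaceK b i x y : replace (replace b i x) i y = replace b i y.
Proof. by apply/rowP => j; rewrite !mxE; case: eqP. Qed.

Lemma replace_id b i : replace b i (b 0 i) = b.
Proof. by apply/rowP => j; rewrite !mxE; case: eqP => [->|]. Qed.

Lemma replace_in_box b i x :
  box lo hi b -> x \in `[lo i, hi i] -> box lo hi (replace b i x).
Proof. by move=> bb xi j; rewrite mxE; case: eqP => [->|]. Qed.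

Lemma pquotientE f b j y x :
  pquotient f j (replace b j y) x = quotient (fun z => f (replace b j z)) y x.
Proof. by rewrite /pquotient /quotient replaceK mxE eqxx. Qed.

Lemma itv_dnbhs_proper (a b y : R) :
  a < b -> y \in `[a, b] -> ProperFilter (within `[a, b]%classic y^').
Proof.
rewrite in_itv/= => ab yab; have [yb|yb] := ltP y b.
  apply: (@within_dnbhs_proper _ _ _ (b - y)); first by lra.
  by left=> z /=; rewrite !in_itv/=; lra.
apply: (@within_dnbhs_proper _ _ _ (y - a)); first by lra.
by right=> z /=; rewrite !in_itv/=; lra.
Qed.

Lemma pderivable_is_derive f b j y : y \in `]lo j, hi j[ ->
  pderivable lo hi f j (replace b j y) ->
  is_derive y 1 (fun z => f (replace b j z)) (pderive lo hi f j (replace b j y)).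
Proof.
move=> yj fd; apply: (quotient_itv_is_derive yj).
have {}fd : pquotient f j (replace b j y) x @[x --> within `[lo j, hi j] y^'] -->
    pderive lo hi f j (replace b j y) by move: fd; rewrite /pderivable /pderive mxE eqxx.
by rewrite -(eq_cvg _ _ (pquotientE f b j y)).
Qed.

Lemma cvg_row (T : Type) (F : set_system T) {FF : Filter F}
    (h : T -> 'rV[R]_N) c :
  (forall j, h t 0 j @[t --> F] --> c 0 j) -> h t @[t --> F] --> c.
Proof.
move=> hc; apply/cvg_ballP => e e0.
have H : \forall t \near F, forall j, ball (c 0 j) e (h t 0 j).
  by apply: filter_forall => j; move/cvg_ballP : (hc j); exact.
near=> x; split => // i j; rewrite (ord1 i).
by move: j; near: x.
Unshelve. all: by end_near. Qed.

(** Continuity relative to the box, in a form where a moving profile need only converge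
    coordinatewise and stay in the box eventually. *)
Lemma box_cvg (T : Type) (F : set_system T) {FF : Filter F}
    (h : T -> 'rV[R]_N) f c :
  {within box lo hi, continuous f} -> box lo hi c ->
  (\forall t \near F, box lo hi (h t)) ->
  (forall j, h t 0 j @[t --> F] --> c 0 j) -> f (h t) @[t --> F] --> f c.
Proof.
move=> /subspace_continuousP fc bc bh hc U /(fc _ bc) fU.
have {}fU : nbhs c (fun z => box lo hi z -> U (f z)) := fU.
have {}fU : F (fun t => box lo hi (h t) -> U (f (h t))) := cvg_row (FF := FF) hc fU.
change (F (fun t => U (f (h t)))).
have {}bh : F (fun t => box lo hi (h t)) := bh.
by apply: filterS2 bh fU => t bt; exact.
Qed.

Lemma replace_continuous f b i : {within box lo hi, continuous f} -> box lo hi b ->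
  {within `[lo i, hi i], continuous (fun z => f (replace b i z))}.
Proof.
move=> fc bb; apply/subspace_continuousP => x xi.
apply: box_cvg => //.
- exact: replace_in_box.
- apply: (@filterE _ (nbhs x)) => y yi; exact: replace_in_box.
- move=> j; rewrite mxE; under eq_fun do rewrite mxE.
  case: eqP => _; last exact: cvg_cst.
  by apply: cvg_within_filter; exact: cvg_id.
Qed.

End Profiles.

(** * Best responses *)

Section BestResponse.
Variables (R : realType) (N : nat) (G : pooling_game R N).
Implicit Types (b c : 'rV[R]_N) (i j : 'I_N) (x y s : R).

Let lo := bmin G.
Let hi := bmax G.

Definition marginal i : 'rV[R]_N -> R := pderive lo hi (utility G i) i.
Definition curvature i : 'rV[R]_N -> R := pderive lo hi (marginal i) i.

Lemma utility_is_derive b i x : profiles G b -> x \in `]lo i, hi i[ ->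
  is_derive x 1 (fun z => utility G i (replace b i z)) (marginal i (replace b i x)).
Proof.
move=> bb xi; apply: pderivable_is_derive => //.
by have [_ /(_ i)[+ _] _] := utility_C2 G i; apply; apply: replace_in_box => //; exact: itv_ooW.
Qed.

Lemma marginal_is_derive b i x : profiles G b -> x \in `]lo i, hi i[ ->
  is_derive x 1 (fun z => marginal i (replace b i z)) (curvature i (replace b i x)).
Proof.
move=> bb xi; apply: pderivable_is_derive => //.
by have [_ _ /(_ i i)[+ _]] := utility_C2 G i; apply; apply: replace_in_box => //; exact: itv_ooW.
Qed.

Lemma utility_within_continuous b i : profiles G b ->
  {within `[lo i, hi i], continuous (fun z => utility G i (replace b i z))}.
Proof. by apply: replace_continuous; have [] := utility_C2 G i. Qed.

Lemma marginal_continuous i : {within profiles G, continuous (marginal i)}.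
Proof. by have [_ /(_ i)[_ ?] _] := utility_C2 G i. Qed.

Lemma curvature_continuous i : {within profiles G, continuous (curvature i)}.
Proof. by have [_ _ /(_ i i)[_ ?]] := utility_C2 G i. Qed.

(** The points [x] and [y] may be endpoints of the strategy interval: the mean value theorem asks
    there for continuity alone, and for two-sided derivatives strictly between. *)
Lemma marginal_MVT b i x y : profiles G b ->
  x \in `[lo i, hi i] -> y \in `[lo i, hi i] -> x < y ->
  exists2 z, z \in `]x, y[ & marginal i (replace b i y) - marginal i (replace b i x) =
    curvature i (replace b i z) * (y - x).
Proof.
move=> bb xi yi xy.
apply: (@MVT _ (fun z => marginal i (replace b i z)) (fun z => curvature i (replace b i z))) => //.
  by move=> z zxy; apply: marginal_is_derive => //; exact: sub_itv_oo zxy.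
apply: continuous_subspaceW (sub_itv xi yi) _.
by apply: replace_continuous => //; exact: marginal_continuous.
Qed.

Lemma utility_MVT b i x y : profiles G b ->
  x \in `[lo i, hi i] -> y \in `[lo i, hi i] -> x < y ->
  exists2 z, z \in `]x, y[ & utility G i (replace b i y) - utility G i (replace b i x) =
    marginal i (replace b i z) * (y - x).
Proof.
move=> bb xi yi xy.
apply: (@MVT _ (fun z => utility G i (replace b i z)) (fun z => marginal i (replace b i z))) => //.
  by move=> z zxy; apply: utility_is_derive => //; exact: sub_itv_oo zxy.
by apply: continuous_subspaceW (sub_itv xi yi) _; exact: utility_within_continuous.
Qed.

Lemma marginal_decreasing b i x y : profiles G b ->
  x \in `[lo i, hi i] -> y \in `[lo i, hi i] -> x < y ->
  marginal i (replace b i y) < marginal i (replace b i x).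
Proof.
move=> bb xi yi xy; have [z zxy e] := marginal_MVT bb xi yi xy.
rewrite -subr_lt0 e nmulr_rlt0 ?subr_gt0//; apply: utility_concave.
by apply: replace_in_box => //; apply: itv_ooW; exact: sub_itv_oo zxy.
Qed.

(** If two maximizers satisfied [y < x], Rolle would give a zero [z] of the marginal between them.
    The marginal is negative beyond [z], so the utility at [x] would fall below that at [z]. *)
Lemma best_responses_le i b x y : profiles G b ->
  best_responses G i b x -> best_responses G i b y -> x <= y.
Proof.
move=> bb [xi xmax] [yi ymax]; rewrite leNgt; apply/negP => yx.
have Uc : {within `[y, x], continuous (fun z => utility G i (replace b i z))}.
  exact: continuous_subspaceW (sub_itv yi xi) (utility_within_continuous bb).
have Ud z : z \in `]y, x[ -> is_derive z 1 (fun z => utility G i (replace b i z))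
    (marginal i (replace b i z)).
  by move=> zyx; apply: utility_is_derive => //; exact: sub_itv_oo zyx.
have [| |z zyx dz] := Rolle yx _ Uc.
- by move=> z /Ud[].
- by apply/eqP; rewrite eq_le ymax// xmax.
have z0 : marginal i (replace b i z) = 0.
  by have dz' := Ud _ zyx; rewrite -(@derive_val _ _ _ _ _ _ _ dz') (@derive_val _ _ _ _ _ _ _ dz).
have zx : z < x by move: zyx; rewrite in_itv/=; lra.
have zi : z \in `[lo i, hi i] by apply: itv_ooW; exact: sub_itv_oo zyx.
have [w wzx e] := utility_MVT bb zi xi zx.
have := xmax _ zi; rewrite -subr_ge0 e pmulr_lge0 ?subr_gt0// leNgt => /negP; apply.
rewrite -z0; apply: marginal_decreasing => //.
  by apply: itv_ooW; exact: sub_itv_oo wzx.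
by move: wzx; rewrite in_itv/= => /andP[].
Qed.

Lemma BRP i b : profiles G b -> best_responses G i b (BR G i b).
Proof.
move=> bb; apply: getPex.
have [x xi xmax] := EVT_max (ltW (bmin_lt_bmax G i)) (utility_within_continuous (i := i) bb).
by exists x.
Qed.

Lemma BR_unique i b x : profiles G b -> best_responses G i b x -> BR G i b = x.
Proof.
move=> bb xb; have yb := BRP i bb.
by apply/le_anti; rewrite !(best_responses_le (i := i) bb).
Qed.

Lemma BR_in i b : profiles G b -> BR G i b \in `[lo i, hi i].
Proof. by move=> /(BRP i)[]. Qed.

Lemma nashP b : profiles G b -> nash G b <-> forall i, BR G i b = b 0 i.
Proof.
move=> bb; split=> [[_ nb] i|bBR].
  by apply: BR_unique => //; split; [exact: bb | move=> y /nb; rewrite replace_id].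
split=> // i y yi; have [_ /(_ y yi)] := BRP i bb.
by rewrite bBR replace_id.
Qed.

Lemma BR_first_order i b : profiles G b -> BR G i b \in `]lo i, hi i[ ->
  marginal i (replace b i (BR G i b)) = 0.
Proof.
move=> bb bi; have [_ bmax] := BRP i bb.
have Ud z : z \in `]lo i, hi i[ -> is_derive z 1 (fun z => utility G i (replace b i z))
    (marginal i (replace b i z)) by exact: utility_is_derive.
have d0 : is_derive (BR G i b) 1 (fun z => utility G i (replace b i z)) 0.
  apply: derive1_at_max (ltW (bmin_lt_bmax G i)) _ bi _.
    by move=> t /Ud[].
  by move=> t /itv_ooW; exact: bmax.
have d1 := Ud _ bi.
by rewrite -(@derive_val _ _ _ _ _ _ _ d1) (@derive_val _ _ _ _ _ _ _ d0).
Qed.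

Lemma BR_replace i b x : BR G i (replace b i x) = BR G i b.
Proof.
rewrite /BR; congr get; rewrite /best_responses.
by apply/seteqP; split=> y [yi ymax]; split=> // z /ymax; rewrite !replaceK.
Qed.

End BestResponse.

(** * Dependence on the opponents' sum *)

Section Aggregate.
Variables (R : realType) (N : nat) (G : pooling_game R N).
Implicit Types (b c : 'rV[R]_N) (i j : 'I_N) (x y s t : R).

Let lo := bmin G.
Let hi := bmax G.

Definition others i b : R := \sum_(j < N | j != i) b 0 j.
Definition others_min i : R := \sum_(j < N | j != i) lo j.
Definition others_max i : R := \sum_(j < N | j != i) hi j.

(* A profile with own strategy [x] and opponents' sum [s], the opponents being placed
   on the diagonal of their box; it leaves the box when [s] is out of range. *)
Definition spread i x s : 'rV[R]_N :=
  \row_j if j == i then x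
         else lo j + (s - others_min i) / (others_max i - others_min i) * (hi j - lo j).

(** Stated for any [F], since it is applied to utilities, marginals and best responses. *)
Definition aggregative i (F : 'rV[R]_N -> R) := forall b c,
  profiles G b -> profiles G c -> b 0 i = c 0 i -> others i b = others i c -> F b = F c.

Lemma others_min_lt_max i j : j != i -> others_min i < others_max i.
Proof.
move=> ji; rewrite /others_min /others_max (bigD1 j)//= [ltRHS](bigD1 j)//=.
rewrite ltr_leD ?bmin_lt_bmax//; apply: ler_sum => k _; exact/ltW/bmin_lt_bmax.
Qed.

Lemma others_in i b : profiles G b -> others i b \in `[others_min i, others_max i].
Proof.
move=> bb; rewrite in_itv/=; apply/andP; split; apply: ler_sum => j _;
  by have := bb j; rewrite in_itv/= => /andP[].
Qed.

Lemma others_replace i j b x : j != i ->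
  others i (replace b j x) = others i b - b 0 j + x.
Proof.
move=> ji; rewrite /others (bigD1 j)//= [in RHS](bigD1 j)//= mxE eqxx.
under eq_bigr => k /andP[_ /negbTE kj] do rewrite mxE kj.
by ring.
Qed.

Lemma others_replace_own i b x : others i (replace b i x) = others i b.
Proof. by apply: eq_bigr => j /negbTE ji; rewrite mxE ji. Qed.

Lemma spread_own i x s : spread i x s 0 i = x.
Proof. by rewrite mxE eqxx. Qed.

Lemma replace_spread i x s y : replace (spread i x s) i y = spread i y s.
Proof. by apply/rowP => j; rewrite !mxE; case: eqP. Qed.

Lemma others_spread i j x s : j != i -> others i (spread i x s) = s.
Proof.
move=> /others_min_lt_max lu; rewrite /others.
under eq_bigr => k /negbTE ki do rewrite mxE ki.
rewrite big_split/= -mulr_sumr sumrB -/(others_min i) -/(others_max i).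
by rewrite divfK ?subr_eq0 ?gt_eqF//; ring.
Qed.

Lemma spread_in i x s :
  x \in `[lo i, hi i] -> s \in `[others_min i, others_max i] -> profiles G (spread i x s).
Proof.
move=> xi si j; rewrite mxE; have [->//|ji] := eqVneq j i.
have lu := others_min_lt_max ji; have lh := bmin_lt_bmax G j.
move: si; rewrite !in_itv/= => /andP[s1 s2].
set r := _ / _; have r0 : 0 <= r by apply: divr_ge0; rewrite subr_ge0// ltW.
have r1 : r <= 1 by rewrite ler_pdivrMr ?subr_gt0// mul1r lerD2r.
by rewrite /lo /hi; apply/andP; split; nra.
Qed.

Lemma spread_interior i j x s : j != i -> s \in `]others_min i, others_max i[ ->
  spread i x s 0 j \in `]lo j, hi j[.
Proof.
move=> ji; rewrite mxE (negbTE ji).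
have lu := others_min_lt_max ji; have lh := bmin_lt_bmax G j.
rewrite !in_itv/= => /andP[s1 s2].
set r := _ / _; have r0 : 0 < r by rewrite divr_gt0// subr_gt0.
have r1 : r < 1 by rewrite ltr_pdivrMr ?subr_gt0// mul1r ltrD2r.
by rewrite /lo /hi; apply/andP; split; nra.
Qed.

(** A move of opponent [j] shifts the opponents' sum by the same amount, so both difference
    quotients coincide. The set [A] restricts to sums that [j] alone can reach within the box, near
    the current one. *)
Lemma aggregative_quotient i j F b (A : set R) :
  aggregative i F -> profiles G b -> j != i -> pderivable lo hi F j b ->
  (\forall t \near others i b, A t -> t - others i b + b 0 j \in `[lo j, hi j]) ->
  quotient (fun t => F (spread i (b 0 i) t)) (others i b) t
    @[t --> within A (others i b)^'] --> pderive lo hi F j b.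
Proof.
move=> Fagg bb ji Fd At.
have := @cvg_within_shift _ _ A `[lo j, hi j]%classic _ _ _ _ At Fd.
apply: cvg_trans; apply: near_eq_cvg.
set s := others i b in At *.
have {}At : nbhs s (fun t => A t -> t - s + b 0 j \in `[lo j, hi j]) := At.
change (nbhs s (fun t => t != s -> A t ->
  pquotient F j b (t - s + b 0 j) = quotient (fun t => F (spread i (b 0 i) t)) s t)).
apply: filterS At => t At ts /At tj; rewrite /pquotient /quotient addrK.
have rb : profiles G (replace b j (t - s + b 0 j)) by exact: replace_in_box.
have rt : others i (replace b j (t - s + b 0 j)) = t.
  by rewrite others_replace// -/s; ring.
congr ((_ - _) / _); apply: Fagg => //.
- by apply: spread_in; [exact: bb|rewrite -rt; exact: others_in].
- by rewrite spread_own mxE (negbTE (_ : i != j)) // eq_sym.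
- by rewrite rt (others_spread _ _ ji).
- by apply: spread_in; [exact: bb|exact: others_in].
- by rewrite spread_own.
- by rewrite (others_spread _ _ ji).
Qed.

Lemma utility_agg i : aggregative i (utility G i).
Proof. by move=> b c; exact: utility_aggregative. Qed.

(** Moving the own strategy keeps the opponents' sum, so the quotients at [b] and [c] agree before
    the limit is taken. *)
Lemma aggregative_pderive_own i F : aggregative i F ->
  (forall b, profiles G b -> pderivable lo hi F i b) -> aggregative i (pderive lo hi F i).
Proof.
move=> Fagg Fd b c bb cc bci bco.
have Fb := Fd _ bb; have Fc := Fd _ cc.
rewrite /pderivable in Fb Fc.
have lohi := bmin_lt_bmax G i.
have PF := itv_dnbhs_proper lohi (cc i).
apply/esym; rewrite /pderive; apply: cvg_lim => //.
move: Fb; rewrite bci; apply: cvg_trans; apply: near_eq_cvg.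
change (nbhs (c 0 i) (fun x => x != c 0 i -> x \in `[lo i, hi i] ->
  pquotient F i b x = pquotient F i c x)).
apply: filterE => x _ xi; rewrite /pquotient bci.
congr ((_ - _) / _); apply: Fagg => //.
- exact: replace_in_box.
- exact: replace_in_box.
- by rewrite !mxE eqxx.
- by rewrite !others_replace_own.
Qed.

Lemma marginal_agg i : aggregative i (marginal G i).
Proof.
apply: aggregative_pderive_own; first exact: utility_agg.
by have [_ /(_ i)[? _] _] := utility_C2 G i.
Qed.

Lemma BR_agg i b c : profiles G b -> profiles G c -> others i b = others i c ->
  BR G i b = BR G i c.
Proof.
move=> bb cc bco; rewrite /BR; congr get.
have E y : y \in `[lo i, hi i] -> utility G i (replace b i y) = utility G i (replace c i y).
  move=> yi; apply: utility_agg; [exact: replace_in_box|exact: replace_in_box| |].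
    by rewrite !mxE eqxx.
  by rewrite !others_replace_own.
by apply/seteqP; split=> y [yi ymax]; split=> // z zi; have := ymax _ zi; rewrite !E.
Qed.

Lemma BR_aggregative i : aggregative i (BR G i).
Proof. by move=> b c bb cc _; exact: BR_agg. Qed.

(** The own strategy [lo i] is a placeholder, as [BR G i] ignores that coordinate. *)
Definition reply i s : R := BR G i (spread i (lo i) s).

Lemma reply_spread i x s : BR G i (spread i x s) = reply i s.
Proof. by rewrite /reply -(replace_spread i x s (lo i)) BR_replace. Qed.

Lemma lo_in i : lo i \in `[lo i, hi i].
Proof. by rewrite in_itv/= lexx ltW// bmin_lt_bmax. Qed.

Lemma BR_reply i j b : j != i -> profiles G b -> BR G i b = reply i (others i b).
Proof.
move=> ji bb; apply: BR_agg => //; last by rewrite (others_spread _ _ ji).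
by apply: spread_in; [exact: lo_in|exact: others_in].
Qed.

Lemma reply_in i s : s \in `[others_min i, others_max i] -> reply i s \in `[lo i, hi i].
Proof. by move=> si; apply: BR_in; apply: spread_in => //; exact: lo_in. Qed.

Lemma reply_quotient i j b (A : set R) :
  profiles G b -> j != i -> BR_derivable G i j b ->
  (\forall t \near others i b, A t -> t - others i b + b 0 j \in `[lo j, hi j]) ->
  quotient (reply i) (others i b) t @[t --> within A (others i b)^'] --> BR_slope G i j b.
Proof.
move=> bb ji Bd At; have := aggregative_quotient (@BR_aggregative i) bb ji Bd At.
by rewrite /quotient; under eq_fun do rewrite !reply_spread.
Qed.

End Aggregate.

(** * Equality of the slopes of a best response *)

Section Slopes.
Variables (R : realType) (N : nat) (G : pooling_game R N).
Implicit Types (b : 'rV[R]_N) (i j k : 'I_N) (x y s t p q : R).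

Let lo := bmin G.
Let hi := bmax G.
Let smin := others_min G.
Let smax := others_max G.

Lemma spread_continuous i x s j (F : set_system R) {FF : Filter F} (xi : R -> R) :
  xi t @[t --> F] --> x -> F --> s -> spread G i (xi t) t 0 j @[t --> F] --> spread G i x s 0 j.
Proof.
move=> xix Fs; rewrite mxE; under eq_fun do rewrite mxE.
case: eqP => // _; apply: cvgD; first exact: cvg_cst.
apply: cvgM; last exact: cvg_cst.
apply: cvgM; last exact: cvg_cst.
by apply: cvgB; [exact: Fs|exact: cvg_cst].
Qed.

(** Mean value theorem in the own strategy, at fixed sum [t], between the two replies in either
    order. The distance bound forces [y] to [reply G i s] when [t] tends to [s]. *)
Lemma marginal_increment i s t : t \in `[smin i, smax i] -> s \in `[smin i, smax i] ->
  exists y, (y \in `[lo i, hi i] /\ `|y - reply G i s| <= `|reply G i t - reply G i s|) /\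
    marginal G i (spread G i (reply G i t) t) - marginal G i (spread G i (reply G i s) t) =
    curvature G i (spread G i y t) * (reply G i t - reply G i s).
Proof.
move=> ti si; have xi := reply_in si; have yi := reply_in ti.
have bb := spread_in xi ti.
have M z w : z \in `[lo i, hi i] -> w \in `[lo i, hi i] -> z < w ->
  exists2 y, y \in `]z, w[ & marginal G i (spread G i w t) - marginal G i (spread G i z t) =
    curvature G i (spread G i y t) * (w - z).
  by move=> zi wi /(marginal_MVT bb zi wi)[y]; rewrite !replace_spread; exists y.
have [lt|lt|->] := ltgtP (reply G i s) (reply G i t).
- have [y yi' e] := M _ _ xi yi lt; exists y; split => //; split.
    by apply: itv_ooW; exact: sub_itv_oo yi'.
  move: yi'; rewrite in_itv/= => /andP[y1 y2].
  by rewrite !gtr0_norm ?subr_gt0// lerD2r ltW.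
- have [y yi' e] := M _ _ yi xi lt; exists y; split; last by rewrite -opprB e; ring.
  split; first by apply: itv_ooW; exact: sub_itv_oo yi'.
  move: yi'; rewrite in_itv/= => /andP[y1 y2].
  by rewrite !ltr0_norm ?subr_lt0// lerN2 lerD2r ltW.
- exists (reply G i t); rewrite !subrr mulr0; split => //; split => //.
Qed.

(* Differentiates the first-order condition [marginal i (reply i s, s) = 0] along a
   possibly one-sided filter; the right-hand side does not depend on the side. *)
Lemma reply_implicit_slope i j s p (A : set R) : j != i ->
  ProperFilter (within A s^') ->
  s \in `]smin i, smax i[ -> reply G i s \in `]lo i, hi i[ ->
  quotient (reply G i) s t @[t --> within A s^'] --> p ->
  curvature G i (spread G i (reply G i s) s) * p =
    - pderive lo hi (marginal G i) j (spread G i (reply G i s) s).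
Proof.
move=> ji PF si ri qp; set x0 := reply G i s in ri *.
have lim_id : within A s^' --> s.
  by apply: cvg_trans (cvg_within _) _; exact: cvg_within.
have sic : s \in `[smin i, smax i] by exact: itv_ooW.
have ric : x0 \in `[lo i, hi i] by exact: reply_in.
have bs : profiles G (spread G i x0 s) by exact: spread_in.
have rc : reply G i t @[t --> within A s^'] --> x0.
  move=> U Ux; have := quotient_cvg_continuous qp Ux.
  rewrite /= !nbhs_simpl/= => H.
  have {}H : nbhs s (fun t => A t -> U (reply G i t)) := H.
  change (nbhs s (fun t => t != s -> A t -> U (reply G i t))).
  by apply: filterS H => t H _; exact: H.
have tn : \forall t \near within A s^', t \in `[smin i, smax i].
  have : \forall t \near s, t \in `]smin i, smax i[ by exact: near_in_itvoo.
  move=> /lim_id; apply: filterS => t; exact: itv_ooW.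
have rn : \forall t \near within A s^', reply G i t \in `]lo i, hi i[.
  by move/rc : (near_in_itvoo ri).
(* The intermediate points are made a function of [t]; its value 0 out of range is never seen by the
   filter. *)
have xiE t : exists y, t \in `[smin i, smax i] ->
  (y \in `[lo i, hi i] /\ `|y - x0| <= `|reply G i t - x0|) /\
    marginal G i (spread G i (reply G i t) t) - marginal G i (spread G i x0 t) =
    curvature G i (spread G i y t) * (reply G i t - x0).
  have [ti|] := boolP (t \in `[smin i, smax i]); last by exists 0.
  by have [y Hy] := marginal_increment ti sic; exists y.
have [xi Hxi] := choice xiE.
have xic : xi t @[t --> within A s^'] --> x0.
  apply/cvgrPdist_lt => e e0; move/cvgrPdist_lt : rc => /(_ e e0).
  apply: filterS2 tn => t /Hxi[[_ le] _]; rewrite !(distrC x0) => lt.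
  exact: le_lt_trans le lt.
have Kc : curvature G i (spread G i (xi t) t) @[t --> within A s^'] -->
    curvature G i (spread G i x0 s).
  apply: (box_cvg (@curvature_continuous _ _ G i)) => //.
    by apply: filterS tn => t ti; have [[? _] _] := Hxi t ti; exact: spread_in.
  by move=> l; apply: spread_continuous.
have M0 t : t \in `[smin i, smax i] -> reply G i t \in `]lo i, hi i[ ->
    marginal G i (spread G i (reply G i t) t) = 0.
  move=> ti rti; have := BR_first_order (spread_in (lo_in G i) ti) rti.
  by rewrite replace_spread.
have Md : pderivable lo hi (marginal G i) j (spread G i x0 s).
  by have [_ _ /(_ i j)[Md _]] := utility_C2 G i; exact: Md.
have := @aggregative_quotient _ _ G i j _ _ A (@marginal_agg _ _ G i) bs ji Md.
rewrite spread_own (others_spread G _ _ ji).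
have bj := spread_interior x0 ji si.
have At : \forall t \near s, A t -> t - s + spread G i x0 s 0 j \in `[lo j, hi j].
  have : \forall z \near spread G i x0 s 0 j, z \in `[lo j, hi j].
    by apply: filterS (near_in_itvoo bj) => z; exact: itv_ooW.
  rewrite (near_shift s); apply: filterS => t /= H _.
  by rewrite (_ : _ + _ = t + (spread G i x0 s 0 j - s))//; ring.
move=> /(_ At) Mq.
(* One function has two limits. Since the marginal vanishes at [(reply t, t)] and at [(x0, s)], the
   negated quotient of the marginal at fixed [x0] equals the curvature at [xi t] times the quotient
   of the reply. *)
apply/esym; apply: (@cvg_unique _ _ _ (fmap_proper_filter
  (fun t => curvature G i (spread G i (xi t) t) * quotient (reply G i) s t) PF)).
  exact: norm_hausdorff.
- apply: (cvg_trans _ (cvgN Mq)); apply: near_eq_cvg.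
  have E t : t \in `[smin i, smax i] -> reply G i t \in `]lo i, hi i[ ->
      (- quotient (fun t => marginal G i (spread G i x0 t)) s) t =
      curvature G i (spread G i (xi t) t) * quotient (reply G i) s t.
    move=> ti rti; have [_ e] := Hxi t ti; rewrite M0// sub0r in e.
    by rewrite fctE /quotient (M0 s)// mulrA -e; ring.
  by near=> t; apply: E; near: t.
- by apply: cvgM; [exact: Kc|exact: qp].
Unshelve. all: by end_near. Qed.

Lemma reply_slope_unique i j s p q : j != i -> s \in `]smin i, smax i[ ->
  quotient (reply G i) s t @[t --> within [set t | s < t] s^'] --> p ->
  quotient (reply G i) s t @[t --> within [set t | t < s] s^'] --> q ->
  p < 0 -> q < 0 -> p = q.
Proof.
move=> ji si rp rq p0 q0.
have PR : ProperFilter (within [set t | s < t] s^').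
  by apply: (@within_dnbhs_proper _ _ _ 1) => //; left => z /=; rewrite in_itv/= => /andP[].
have PL : ProperFilter (within [set t | t < s] s^').
  by apply: (@within_dnbhs_proper _ _ _ 1) => //; right => z /=; rewrite in_itv/= => /andP[].
have sn : \forall t \near s, t \in `]smin i, smax i[ by exact: near_in_itvoo.
have sic : s \in `[smin i, smax i] by exact: itv_ooW.
(* A negative right slope gives some [t > s] with a smaller reply, so [reply G i s] exceeds [lo i];
   a negative left slope gives some [u < s] with a larger one, so it is below [hi i]. *)
have ri : reply G i s \in `]lo i, hi i[.
  have [t /= [st [ti qt]]] : exists t, s < t /\ (t \in `]smin i, smax i[) /\
      quotient (reply G i) s t < 0.
    apply: (@filter_ex _ _ PR).
    have H : \forall t \near within [set t | s < t] s^', quotient (reply G i) s t < 0.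
      by apply: cvgr_lt rp _ p0.
    have {}H : nbhs s (fun t => t != s -> s < t -> quotient (reply G i) s t < 0) := H.
    change (nbhs s (fun t => t != s -> s < t -> s < t /\ (t \in `]smin i, smax i[) /\
      quotient (reply G i) s t < 0)).
    by apply: filterS2 sn H => t ti H ts st; split => //; split => //; exact: H.
  have [u /= [us [ui qu]]] : exists u, u < s /\ (u \in `]smin i, smax i[) /\
      quotient (reply G i) s u < 0.
    apply: (@filter_ex _ _ PL).
    have H : \forall t \near within [set t | t < s] s^', quotient (reply G i) s t < 0.
      by apply: cvgr_lt rq _ q0.
    have {}H : nbhs s (fun t => t != s -> t < s -> quotient (reply G i) s t < 0) := H.
    change (nbhs s (fun t => t != s -> t < s -> t < s /\ (t \in `]smin i, smax i[) /\
      quotient (reply G i) s t < 0)).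
    by apply: filterS2 sn H => t' ti' H ts st'; split => //; split => //; exact: H.
  have rt := reply_in (itv_ooW ti); have ru := reply_in (itv_ooW ui).
  move: rt ru qt qu; rewrite /quotient !in_itv/= => /andP[rt _] /andP[_ ru] qt qu.
  apply/andP; split.
    apply: le_lt_trans rt _; move: qt.
    by rewrite pmulr_llt0 ?invr_gt0 ?subr_gt0// subr_lt0.
  apply: lt_le_trans _ ru; move: qu.
  by rewrite nmulr_llt0 ?invr_lt0 ?subr_lt0// subr_gt0.
have Kp := reply_implicit_slope ji PR si ri rp.
have Kq := reply_implicit_slope ji PL si ri rq.
have K0 : curvature G i (spread G i (reply G i s) s) < 0.
  by apply: utility_concave; apply: spread_in => //; exact: reply_in.
by apply: (mulfI (ltr0_neq0 K0)); rewrite Kp Kq.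
Qed.

(* At a profile with [b 0 j] minimal and [b 0 k] maximal, the two slopes are a right
   and a left derivative of [reply i] at the same point. As both are negative, the
   reply is interior there and [reply_implicit_slope] applies. *)
Lemma BR_slope_eq i j k b : profiles G b -> j != i -> k != i ->
  BR_derivable G i j b -> BR_derivable G i k b ->
  BR_slope G i j b < 0 -> BR_slope G i k b < 0 ->
  BR_slope G i j b = BR_slope G i k b.
Proof.
move=> bb; set s := others i b.
have PR : ProperFilter (within [set t | s < t] s^').
  by apply: (@within_dnbhs_proper _ _ _ 1) => //; left => z /=; rewrite in_itv/= => /andP[].
have PL : ProperFilter (within [set t | t < s] s^').
  by apply: (@within_dnbhs_proper _ _ _ 1) => //; right => z /=; rewrite in_itv/= => /andP[].
have right l : l != i -> BR_derivable G i l b -> b 0 l < hi l ->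
  quotient (reply G i) s t @[t --> within [set t | s < t] s^'] --> BR_slope G i l b.
  move=> li Bd bl; apply: reply_quotient => //; rewrite -/s.
  have : \forall z \near b 0 l, z < hi l by exact: lt_nbhsl.
  rewrite (near_shift s); apply: filterS => t; rewrite /hi /= => H st.
  move: (bb l); rewrite !in_itv/= => /andP[bl' _].
  by apply/andP; split; lra.
have left l : l != i -> BR_derivable G i l b -> lo l < b 0 l ->
  quotient (reply G i) s t @[t --> within [set t | t < s] s^'] --> BR_slope G i l b.
  move=> li Bd bl; apply: reply_quotient => //; rewrite -/s.
  have : \forall z \near b 0 l, lo l < z by exact: lt_nbhsr.
  rewrite (near_shift s); apply: filterS => t; rewrite /lo /= => H st.
  move: (bb l); rewrite !in_itv/= => /andP[_ bl'].
  by apply/andP; split; lra.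
have mixed l m : l != i -> m != i -> BR_derivable G i l b -> BR_derivable G i m b ->
    b 0 l < hi l -> lo m < b 0 m -> BR_slope G i l b < 0 -> BR_slope G i m b < 0 ->
    BR_slope G i l b = BR_slope G i m b.
  move=> li mi Bl Bm bl bm sl sm.
  (* The sum is above its minimum thanks to [m], and below its maximum thanks to [l]. *)
  have si : s \in `]smin i, smax i[.
    rewrite in_itv/=; apply/andP; split.
      rewrite /smin /s /others_min /others (bigD1 m)//= [ltRHS](bigD1 m)//= ltr_leD//.
      by apply: ler_sum => n _; have := bb n; rewrite in_itv/= => /andP[].
    rewrite /smax /s /others_max /others (bigD1 l)//= [ltRHS](bigD1 l)//= ltr_leD//.
    by apply: ler_sum => n _; have := bb n; rewrite in_itv/= => /andP[].
  exact: reply_slope_unique li si (right _ li Bl bl) (left _ mi Bm bm) sl sm.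
move=> ji ki Bj Bk sj sk.
(* Every coordinate can move in at least one direction. If [j] and [k] share one, their slopes are
   limits along the same filter; otherwise [mixed] applies. *)
have avail l : b 0 l < hi l \/ lo l < b 0 l.
  have [|hb] := ltP (b 0 l) (hi l); [by left|right].
  exact: lt_le_trans (bmin_lt_bmax G l) hb.
have [bj|bj] := avail j; have [bk|bk] := avail k.
- by apply: (cvg_unique _ (right _ ji Bj bj) (right _ ki Bk bk)); exact: norm_hausdorff.
- exact: mixed.
- by apply/esym; exact: mixed.
- by apply: (cvg_unique _ (left _ ji Bj bj) (left _ ki Bk bk)); exact: norm_hausdorff.
Qed.

End Slopes.

(** * Fixed points of decreasing replies to an aggregate *)

Section AggregateFixpoint.
Variables (R : realType) (n : nat) (lo hi : 'I_n -> R) (phi : 'I_n -> R -> R).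
Hypothesis phi_in : forall i s, phi i s \in `[lo i, hi i].
Hypothesis phi_dec : forall i s t, s < t -> 0 <= phi i s - phi i t < t - s.
Implicit Types (i : 'I_n) (s t x y S T : R).

Lemma phi_le i s t : s <= t -> 0 <= phi i s - phi i t <= t - s.
Proof.
rewrite le_eqVlt => /predU1P[->|/(phi_dec i)/andP[-> /ltW->]//].
by rewrite !subrr lexx.
Qed.

Lemma phi_continuous i : continuous (phi i).
Proof.
move=> s; apply/cvgrPdist_lt => e e0; near=> t.
apply: (@le_lt_trans _ _ `|s - t|); last by near: t; exact: cvgr_dist_lt.
have [st|/ltW ts] := leP s t.
  have /andP[p q] := phi_le i st.
  by rewrite ger0_norm// distrC ger0_norm// subr_ge0.
have /andP[p q] := phi_le i ts.
by rewrite distrC ger0_norm// ger0_norm// subr_ge0.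
Unshelve. all: by end_near. Qed.

Lemma sub_reply_le i S x y :
  x <= y -> 0 <= (y - phi i (S - y)) - (x - phi i (S - x)).
Proof.
move=> xy; have yx : S - y <= S - x by rewrite lerD2l lerN2.
by have /andP[_] := phi_le i yx; lra.
Qed.

(** Raising [x] lowers [S - x], and the reply then grows by less than [x] does. *)
Lemma sub_reply_lt i S x y :
  x < y -> x - phi i (S - x) < y - phi i (S - y).
Proof.
move=> xy; have yx : S - y < S - x by rewrite ltrD2l ltrN2.
by have /andP[_] := phi_dec i yx; lra.
Qed.

(** If [x < y], strict growth of [z - phi i (S - z)] gives [phi i (S - y) < y], while [S <= T] gives
    [y = phi i (T - y) <= phi i (S - y)]. *)
Lemma cumulative_reply_le i S T x y :
  S <= T -> x = phi i (S - x) -> y = phi i (T - y) -> y <= x.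
Proof.
move=> ST xE yE; rewrite leNgt; apply/negP => xy.
have := sub_reply_lt i S xy; rewrite -xE subrr.
have le : S - y <= T - y by rewrite lerD2r.
by have /andP[+ _] := phi_le i le; rewrite -yE; lra.
Qed.

Lemma cumulative_reply_exists i S : exists x, x = phi i (S - x).
Proof.
pose h x := x - phi i (S - x).
have hc : continuous h.
  move=> x; apply: cvgB; first exact: cvg_id.
  apply: (@cvg_comp _ _ _ (fun x => S - x) (phi i)); last exact: phi_continuous.
  by apply: cvgB; [exact: cvg_cst|exact: cvg_id].
have lohi : lo i <= hi i.
  by have := phi_in i 0; rewrite in_itv/= => /andP[]; exact: le_trans.
have [||x _ hx] := @IVT _ h _ _ 0 lohi.
- exact: continuous_subspaceT.
- rewrite ge_min le_max !subr_le0 !subr_ge0.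
  have := phi_in i (S - lo i); have := phi_in i (S - hi i).
  by rewrite !in_itv/= => /andP[_ ->] /andP[-> _]; rewrite orbT.
by exists x; apply/eqP; rewrite -subr_eq0; apply/eqP.
Qed.

(** At total [S], [x - phi i (S - x)] has strict opposite signs at [r S - e] and [r S + e]. The
    signs persist for [T] near [S], and monotonicity traps [r T] between these points. *)
Lemma cumulative_reply_continuous i (r : R -> R) :
  (forall S, r S = phi i (S - r S)) -> continuous r.
Proof.
move=> rE S; apply/cvgrPdist_lt => e e0.
have pc x : (fun T => phi i (T - x)) T @[T --> S] --> phi i (S - x).
  apply: (@cvg_comp _ _ _ (fun T => T - x) (phi i)); last exact: phi_continuous.
  by apply: cvgB; [exact: cvg_id|exact: cvg_cst].
have up : \forall T \near S, phi i (T - (r S + e)) < r S + e.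
  apply: (cvgr_lt _ (pc _)).
  have /(sub_reply_lt i S) : r S < r S + e by lra.
  by rewrite -rE; lra.
have dn : \forall T \near S, r S - e < phi i (T - (r S - e)).
  apply: (cvgr_gt _ (pc _)).
  have /(sub_reply_lt i S) : r S - e < r S by lra.
  by rewrite -rE; lra.
apply: filterS2 up dn => T up dn; rewrite ltr_norml; apply/andP; split.
  rewrite ltNge; apply/negP => le.
  have /(sub_reply_le i T) : r S + e <= r T by lra.
  by rewrite -rE; lra.
rewrite ltNge; apply/negP => le.
have /(sub_reply_le i T) : r T <= r S - e by lra.
by rewrite -rE; lra.
Qed.

(** The function [f] is nonnegative at the sum of the lower bounds and nonpositive at the sum of the
    upper bounds; a zero of it is a consistent total. *)
Lemma aggregate_fixpoint_exists :
  exists x : 'rV[R]_n, forall i, x 0 i = phi i (\sum_j x 0 j - x 0 i).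
Proof.
have rex i : exists r : R -> R, forall S, r S = phi i (S - r S).
  by have [r rE] := choice (cumulative_reply_exists i); exists r.
have [r rE] := choice rex.
have rc i : continuous (r i) by exact: cumulative_reply_continuous.
pose f S := \sum_i r i S - S.
have fc : continuous f.
  move=> S; apply: cvgB; last exact: cvg_id.
  apply: cvg_big => [|i _]; last exact: rc.
  exact: add_continuous.
have rin i S : lo i <= r i S <= hi i.
  by have := phi_in i (S - r i S); rewrite -rE in_itv.
have le : \sum_i lo i <= \sum_i hi i.
  by apply: ler_sum => i _; have /andP[] := rin i 0; exact: le_trans.
have [||S _ fS] := @IVT _ f _ _ 0 le.
- exact: continuous_subspaceT.
- rewrite ge_min le_max /f !subr_le0 !subr_ge0.
  apply/andP; split; apply/orP; [right|left]; apply: ler_sum => i _.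
    by have /andP[] := rin i (\sum_i hi i).
  by have /andP[] := rin i (\sum_i lo i).
exists (\row_i r i S) => i; under eq_bigr do rewrite mxE.
rewrite mxE; have -> : \sum_j r j S = S by apply/eqP; rewrite -subr_eq0; apply/eqP.
exact: rE.
Qed.

(** The fixed point with the larger total has the smaller coordinates, so the totals agree; the
    comparison then runs both ways. *)
Lemma aggregate_fixpoint_unique (x y : 'rV[R]_n) :
  (forall i, x 0 i = phi i (\sum_j x 0 j - x 0 i)) ->
  (forall i, y 0 i = phi i (\sum_j y 0 j - y 0 i)) -> x = y.
Proof.
wlog le : x y / \sum_j x 0 j <= \sum_j y 0 j => [H xE yE|xE yE].
  have [/H|/ltW/H] := leP (\sum_j x 0 j) (\sum_j y 0 j); first exact.
  by move=> ->.
have yx i : y 0 i <= x 0 i := cumulative_reply_le le (xE i) (yE i).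
have ge : \sum_j y 0 j <= \sum_j x 0 j by exact: ler_sum.
apply/rowP => i; apply/le_anti; rewrite yx andbT.
exact: cumulative_reply_le ge (yE i) (xE i).
Qed.

End AggregateFixpoint.

(** * Equilibrium and the Jacobian of the JP update *)

Lemma other_player N : (2 <= N)%N -> forall i : 'I_N, exists j, j != i.
Proof.
move=> N2 i; have /card_gt0P[j ji] : (0 < #|predC1 i|)%N.
  by rewrite cardC1 card_ord -subn1 subn_gt0.
by exists j.
Qed.

Section Nash.
Variables (R : realType) (N : nat) (G : pooling_game R N).
Implicit Types (b : 'rV[R]_N) (i j : 'I_N) (x y s t : R).

Let lo := bmin G.
Let hi := bmax G.
Let smin := others_min G.
Let smax := others_max G.

Lemma reply_decreasing i j : j != i ->
  (forall b, profiles G b -> BR_derivable G i j b /\ -1 < BR_slope G i j b < 0) ->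
  forall s t, s \in `[smin i, smax i] -> t \in `[smin i, smax i] -> s < t ->
  0 <= reply G i s - reply G i t < t - s.
Proof.
move=> ji slope s t si ti st.
pose b s := spread G i (lo i) s; pose sigma s := BR_slope G i j (b s).
have bb u : u \in `[smin i, smax i] -> profiles G (b u).
  by move=> ui; apply: spread_in => //; exact: lo_in.
have rq u : u \in `[smin i, smax i] ->
    quotient (reply G i) u v @[v --> within `[smin i, smax i] u^'] --> sigma u.
  move=> ui; have [Bd _] := slope _ (bb u ui).
  have bo : others i (b u) = u := others_spread _ _ _ ji.
  have := @reply_quotient _ _ G i j (b u) `[smin i, smax i]%classic (bb u ui) ji Bd.
  rewrite bo; apply.
  have lu := others_min_lt_max G ji; have lh := bmin_lt_bmax G j.
  have bE : b u 0 j = lo j + (u - smin i) / (smax i - smin i) * (hi j - lo j).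
    by rewrite mxE (negbTE ji).
  set r := _ / _ in bE.
  have rE : r * (smax i - smin i) = u - smin i.
    by rewrite divfK// subr_eq0 gt_eqF.
  (* Below [smax i], player [j] has room upwards. At [smax i], the condition [v <= smax i] only
     allows a downward move. The bound [dn] is symmetric. *)
  have up : \forall v \near u, v <= smax i -> v - u + b u 0 j <= hi j.
    have [um|um] := ltP u (smax i).
      have r1 : r < 1 by rewrite ltr_pdivrMr ?subr_gt0// mul1r ltrD2r.
      have bl : b u 0 j < hi j by rewrite bE /lo /hi; nra.
      have : \forall z \near b u 0 j, z < hi j by exact: lt_nbhsl.
      by rewrite (near_shift u); apply: filterS => v /= + _; lra.
    apply: (@filterE _ (nbhs u)) => v vm.
    by have := bb u ui j; rewrite in_itv/= => /andP[_]; rewrite -/hi; lra.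
  have dn : \forall v \near u, smin i <= v -> lo j <= v - u + b u 0 j.
    have [um|um] := ltP (smin i) u.
      have r0 : 0 < r by rewrite divr_gt0// subr_gt0.
      have bl : lo j < b u 0 j by rewrite bE /lo /hi; nra.
      have : \forall z \near b u 0 j, lo j < z by exact: lt_nbhsr.
      by rewrite (near_shift u); apply: filterS => v /= + _; lra.
    apply: (@filterE _ (nbhs u)) => v vm.
    by have := bb u ui j; rewrite in_itv/= => /andP[+ _]; rewrite -/lo; lra.
  apply: filterS2 up dn => v up dn; rewrite /= !in_itv/= => /andP[v1 v2].
  by rewrite up ?dn.
have [|| v vst e] := @MVT _ (reply G i) sigma s t st.
- move=> v vst; have vi := sub_itv_oo si ti vst.
  by apply: (quotient_itv_is_derive vi); apply: rq; exact: itv_ooW.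
- apply/subspace_continuousP => v /= vst.
  have sub := sub_itv si ti.
  have := quotient_cvg_continuous (rq v (sub _ vst)).
  apply: cvg_trans; apply: cvg_fmap2; exact: within_subset.
have vi : v \in `[smin i, smax i] by apply: itv_ooW; exact: sub_itv_oo vst.
have [_ /andP[sl sr]] := slope _ (bb v vi).
rewrite -/(sigma v) in sl sr.
by apply/andP; split; nra.
Qed.

(** Projection onto the attainable sums. It extends replies to the whole line and, being monotone
    and 1-Lipschitz, preserves their monotonicity and strict contraction. *)
Definition clamp i s : R := Num.max (smin i) (Num.min s (smax i)).

Lemma clamp_in i j s : j != i -> clamp i s \in `[smin i, smax i].
Proof.
move=> ji; have lu := others_min_lt_max G ji.
by rewrite in_itv/= le_max lexx/= ge_max ge_min lexx orbT andbT ltW.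
Qed.

Lemma clamp_id i s : s \in `[smin i, smax i] -> clamp i s = s.
Proof. by rewrite in_itv/= => /andP[? ?]; rewrite /clamp min_l// max_r. Qed.

Lemma clamp_dist i s t : s <= t -> 0 <= clamp i t - clamp i s <= t - s.
Proof.
move=> st; rewrite /clamp; case: (leP s (smax i)) => ?; case: (leP t (smax i)) => ?;
  by do ?case: (leP (smin i)) => ?; lra.
Qed.

Lemma JP_fixed (kappa : 'I_N -> R) b : (forall i, kappa i != 0) -> profiles G b ->
  JP_map G kappa b = b <-> nash G b.
Proof.
move=> k0 bb; rewrite nashP//; split=> [e i|e].
  move/rowP: e => /(_ i); rewrite mxE => e.
  by apply: (mulfI (k0 i)); lra.
by apply/rowP => i; rewrite mxE e; ring.
Qed.

Lemma JP_quotient (kappa : 'I_N -> R) b i j : profiles G b ->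
  (j != i -> BR_derivable G i j b) ->
  pquotient (fun c => JP_map G kappa c 0 i) j b x
    @[x --> within `[lo j, hi j] (b 0 j)^'] -->
    if i == j then 1 - kappa i else kappa i * BR_slope G i j b.
Proof.
(* In the own direction the best response is constant, so the quotient is exactly [1 - kappa i]. *)
move=> bb Bd; case: eqVneq => [<-{j Bd}|ij].
  have H : (cst (1 - kappa i) : R -> R) x @[x --> within `[lo i, hi i] (b 0 i)^'] --> 1 - kappa i.
    exact: cvg_cst.
  apply: cvg_trans H; apply: near_eq_cvg.
  apply: (@filterE _ (nbhs (b 0 i))) => x xb _.
  rewrite /pquotient !mxE eqxx BR_replace /cst.
  by apply: (mulIf (_ : x - b 0 i != 0)); rewrite ?divfK ?subr_eq0//; ring.
have {}Bd : BR_derivable G i j b by apply: Bd; rewrite eq_sym.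
have H : kappa i * pquotient (BR G i) j b x
    @[x --> within `[lo j, hi j] (b 0 j)^'] --> kappa i * BR_slope G i j b.
  by apply: cvgM; [exact: cvg_cst|exact: Bd].
apply: cvg_trans H; apply: near_eq_cvg.
apply: (@filterE _ (nbhs (b 0 j))) => x xb _.
by rewrite /pquotient !mxE (negbTE ij); ring.
Qed.

Lemma JP_pderive (kappa : 'I_N -> R) b i j : profiles G b ->
  (j != i -> BR_derivable G i j b) ->
  pderive lo hi (fun c => JP_map G kappa c 0 i) j b =
    if i == j then 1 - kappa i else kappa i * BR_slope G i j b.
Proof.
move=> bb Bd; have PF := itv_dnbhs_proper (bmin_lt_bmax G j) (bb j).
by apply: cvg_lim => //; exact: JP_quotient.
Qed.

Lemma jacobian_spectrum (kappa : 'I_N -> R) b : (2 <= N)%N -> profiles G b ->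
  (forall i j, j != i -> [/\ BR_derivable G i j b, -1 < BR_slope G i j b < 0
     & 0 < kappa i < kappa_max G i j b]) ->
  spectrum_lt1 (Defs.jacobian G (JP_map G kappa) b).
Proof.
move=> N2 bb H a; have [other otherP] := choice (other_player N2).
(* With [s] the slope, [d i - w i = 1 - kappa i] is the diagonal entry, [d i < 1] amounts to
   [s > -1], and [N * w i < 1 + d i] to [kappa i * (1 + (N - 1) * |s|) < 2]. *)
pose w i := - (kappa i * BR_slope G i (other i) b); pose d i := 1 - kappa i + w i.
have -> : map_mx (real_complex R) (Defs.jacobian G (JP_map G kappa) b) =
    \matrix_(i, j) ((i == j)%:R * real_complex R (d i) - real_complex R (w i)).
  apply/matrixP => i j; rewrite !mxE JP_pderive//; last by move=> /H[].
  case: eqVneq => [_|ij]; first by rewrite mul1r -rmorphB /d addrK.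
  rewrite mul0r sub0r -rmorphN /w opprK; congr (real_complex _ (_ * _)).
  have ji : j != i by rewrite eq_sym.
  have [Bj /andP[_ sj] _] := H _ _ ji; have [Bo /andP[_ so] _] := H _ _ (otherP i).
  exact: BR_slope_eq.
have wd i : [/\ 0 < w i, d i < 1 & N%:R * w i < 1 + d i].
  have [_ /andP[s1 s0] /andP[k0]] := H _ _ (otherP i).
  have N1 : 1 <= (N%:R : R) by rewrite ler1n ltnW.
  rewrite /kappa_max ltr0_norm// ltr_pdivlMr; last by nra.
  by rewrite /d /w => kmax; split; nra.
apply: diag_rank1_eigenvalue_lt1 => i.
- by rewrite ltcR; have [] := wd i.
- by rewrite ltcR; have [] := wd i.
- have -> : N%:R * real_complex R (w i) = real_complex R (N%:R * w i).
    by rewrite rmorphM rmorph_nat.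
  have -> : 1 + real_complex R (d i) = real_complex R (1 + d i).
    by rewrite (rmorphD (real_complex R) 1) (rmorph1 (real_complex R)).
  by rewrite ltcR; have [] := wd i.
Qed.

Lemma nash_exists_unique : (2 <= N)%N ->
  (forall b i j, profiles G b -> j != i ->
     BR_derivable G i j b /\ -1 < BR_slope G i j b < 0) ->
  exists! b, nash G b.
Proof.
move=> N2 H; have [other otherP] := choice (other_player N2).
pose phi i s := reply G i (clamp i s).
have phi_in i s : phi i s \in `[lo i, hi i].
  by apply: reply_in; exact: clamp_in (otherP i).
have phi_dec i s t : s < t -> 0 <= phi i s - phi i t < t - s.
  move=> st; have /andP[c0 c1] := clamp_dist i (ltW st).
  have [e|ne] := eqVneq (clamp i s) (clamp i t).
    by rewrite /phi e subrr lexx subr_gt0.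
  have cst : clamp i s < clamp i t by rewrite lt_neqAle ne -subr_ge0.
  have Hi b : profiles G b -> BR_derivable G i (other i) b /\ -1 < BR_slope G i (other i) b < 0.
    by move=> bb; exact: H.
  have /andP[-> /=] := reply_decreasing (otherP i) Hi (clamp_in s (otherP i)) (clamp_in t (otherP i)) cst.
  by move=> /lt_le_trans; apply.
have othersE b i : others i b = \sum_j b 0 j - b 0 i.
  by rewrite [in RHS](bigD1 i)//= /others; ring.
have fixP b : nash G b <-> forall i, b 0 i = phi i (\sum_j b 0 j - b 0 i).
  split=> [nb i|bE].
    have bb := nb.1; rewrite -othersE /phi (clamp_id (others_in i bb)).
    by rewrite -((nashP bb).1 nb i); exact: BR_reply (otherP i) bb.
  (* A fixed point is automatically admissible because [phi] takes values in the strategy intervals;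
     hence the clamp acts as the identity on its sums. *)
  have bb : profiles G b by move=> i; rewrite bE.
  apply/nashP => // i.
  by rewrite (BR_reply (otherP i) bb) [RHS]bE -othersE /phi (clamp_id (others_in i bb)).
have [b bE] := aggregate_fixpoint_exists phi_in phi_dec.
exists b; split; first exact/fixP.
by move=> c /fixP cE; exact: aggregate_fixpoint_unique phi_dec _ _ bE cE.
Qed.

End Nash.

(** The Jacobian criterion uses the bounds along the run only, relative to a given unique
    equilibrium; existence and uniqueness use the slope bounds on the whole strategy space. *)
Theorem proposition8 (R : realType) (N : nat) (hN : (2 <= N)%N)
    (G : pooling_game R N) :
  (forall (kappa : nat -> 'I_N -> R) (beta : nat -> 'rV[R]_N),
     JP_run G kappa beta ->
     (forall (t : nat) (i j : 'I_N), j != i ->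
        [/\ BR_derivable G i j (beta t),
            -1 < BR_slope G i j (beta t) < 0
          & 0 < kappa t.+1 i < kappa_max G i j (beta t)]) ->
     forall bstar : 'rV[R]_N, unique (nash G) bstar ->
       JP_converges G kappa beta bstar)
  /\
  ((forall (b : 'rV[R]_N) (i j : 'I_N), profiles G b -> j != i ->
      BR_derivable G i j b /\ -1 < BR_slope G i j b < 0) ->
   exists! bstar : 'rV[R]_N, nash G bstar).
Proof.
split; last by apply: nash_exists_unique.
move=> kappa beta [beta_in _] H bstar [nstar ustar] t.
have [other otherP] := choice (other_player hN).
have k0 i : kappa t.+1 i != 0.
  by have [_ _ /andP[/lt0r_neq0]] := H t _ _ (otherP i).
split.
- move=> b bb; rewrite JP_fixed//; split=> [/ustar ->//|->//].
- move=> i j; apply/cvg_ex; eexists; apply: JP_quotient => //.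
  by move=> /(H t)[].
- by apply: jacobian_spectrum => // i j; exact: H.
Qed.
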